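(* Let $(G,\mathsf X)$ be a contracting self-replicating self-similar group with $G$ finitely generated and with nucleus $\mathcal N$; let $T_0$, $K_{g,0}$, $\kappa_{g,0}$ and the complexes $J_n(G)$ be as defined in the context. For $n\ge1$ define the complex $T_n$ inductively as the quotient of $T_{n-1}\times\mathsf X$ by the identifications $$(\xi,x)\sim(\kappa_{g,n-1}(\xi),g(x))$$ for all $\xi\in K_{g,n-1}$, $x\in\mathsf X$ and $g\in\mathcal N\setminus\{1\}$ such that $g|_x=1$. For $g\in\mathcal N\setminus\{1\}$ let $K_{g,n}$ be the image in $T_n$ of the set $\bigcup_{x\in\mathsf X,\,h\in\mathcal N,\,h|_x=g}K_{h,n-1}\times\{x\}\subset T_{n-1}\times\mathsf X$, and define $\kappa_{g,n}$ on $K_{g,n}$ by the rule $$\kappa_{g,n}:(\xi,x)\mapsto(\kappa_{h,n-1}(\xi),h(x)),$$ where $h\in\mathcal N$ is such that $h|_x=g$ and $\xi\in K_{h,n-1}$. Then the complex $J_n(G)$ is isomorphic to the quotient of $T_n$ by the identifications $\kappa_{g,n}$, $g\in\mathcal N\setminus\{1\}$. The covering $p_n:J_{n+1}(G)\to J_n(G)$ is induced by the map $(\xi,x)\mapsto\xi$ for $\xi\in T_n$, $x\in\mathsf X$. The map $\iota_n:J_{n+1}(G)\to J_n(G)$, for $n\ge1$, is induced by the map $(\xi,x)\mapsto(\iota_{n-1}(\xi),x)$ for $\xi\in T_n$, $x\in\mathsf X$, where $\iota_{n-1}$ denotes here the map $T_n\to T_{n-1}$ inducing $\iota_{n-1}:J_n(G)\to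 J_{n-1}(G)$ (for $n=1$ it is the map $T_1\to T_0$ given by $(\xi,x)\mapsto I_x(\xi)$).
   Context: **Self-similar groups.** A covering $G$-bimodule is a set with commuting left and right $G$-actions such that the right action is free with finitely many orbits; a basis is a set meeting each right orbit once. A self-similar group $(G,\mathsf X)$ is given by a covering bimodule $\mathfrak M=\mathsf X\cdot G$ with basis $\mathsf X$: $g\cdot x=g(x)\cdot g|_x$ with $g(x)\in\mathsf X$, $g|_x\in G$. It is self-replicating if the left action of $G$ on $\mathfrak M$ is transitive. $\mathfrak M^{\otimes n}$ is the $n$-fold tensor power ($x\cdot g\otimes y=x\otimes g\cdot y$), with basis $\mathsf X^n$, and $g\cdot v=g(v)\cdot g|_v$ for $v\in\mathsf X^n$; $A|_v=\{g|_v:g\in A\}$. The group is contracting if there is a finite $\mathcal N\subset G$ such that for each $g\in G$ one has $g|_v\in\mathcal N$ for all sufficiently long words $v$; the smallest such set is the nucleus $\mathcal N$. **Tiling nerve and $J_n(G)$.** $\Gamma(G,\mathcal N)$ is the simplicial complex with vertex set $G$ in which a non-empty $A\subset G$ is a simplex iff $gh^{-1}\in\mathcal N$ for all $g,h\in A$; $G$ acts by right translations. For $v\in\mathsf X^n$ let $I_v$ be the simplicial map with $I_v(g)=g|_v$ on vertices. $\mathcal X\otimes\mathfrak M$ is the quotient of $\mathcal X\times\mathfrak M$ by $\xi\cdot g\otimes x=\xi\otimes g\cdot x$. Put $I^{(n)}(\xi\otimes v\cdot h)=I_v(\xi)\cdot h$, $I=I^{(1)}$. The tiling nerve is $\Gamma=\bigcap_{n\ge0}I^{(n)}(\Gamma(G,\mathcal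 N)\otimes\mathfrak M^{\otimes n})$; its simplices are called adjacency subsets of $G$. Put $\Gamma_n=\Gamma\otimes\mathfrak M^{\otimes n}$ and $J_n(G)=\Gamma_n/G$. The map $p_n:J_{n+1}(G)\to J_n(G)$ is induced by $\xi\otimes v\otimes x\mapsto\xi\otimes v$ ($v\in\mathfrak M^{\otimes n}$, $x\in\mathfrak M$); $\iota_n:J_{n+1}(G)\to J_n(G)$ is induced by $\xi\otimes x\otimes v\mapsto I(\xi\otimes x)\otimes v$ ($x\in\mathfrak M$, $v\in\mathfrak M^{\otimes n}$). **The initial data.** Let $\mathcal A$ be the set of adjacency subsets containing the identity, ordered by inclusion. $T_0$ is the geometric realization of the poset $\mathcal A$, i.e., the union of the simplices of the barycentric subdivision of $\Gamma$ that contain the vertex $1\in G$. For $g\in\mathcal N\setminus\{1\}$, $K_{g,0}\subset T_0$ is the (possibly empty) subcomplex realizing the sub-poset $\mathcal A_g=\{A\in\mathcal A:g\in A\}$, and $\kappa_{g,0}:K_{g,0}\to K_{g^{-1},0}$ is the isomorphism induced by $A\mapsto A\cdot g^{-1}$ (the restriction of $\xi\mapsto\xi\cdot g^{-1}$ to $T_0\cap T_0\cdot g=K_{g,0}$). $J_0(G)$ is the quotient of $T_0$ by the identifications $\kappa_{g,0}$.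
   Formalization: I_v is realized on the barycentric subdivision of Γ (by A ↦ A|_v) rather than affinely on the simplices of Γ; with the affine map I_x need not send T_0 to T_0 (e.g. in the Grigorchuk group, on {1,b,c}). Where the affine map does preserve T_0 the two maps agree. *)

(* Defs.v *)
From HB Require Import structures.
From Stdlib Require Import Relation_Operators.
From mathcomp Require Import all_boot all_order all_algebra.
From mathcomp Require Import generic_quotient.
From mathcomp Require Import boolp classical_sets functions cardinality fsbigop.
From mathcomp Require Import reals.

Set Implicit Arguments.
Unset Strict Implicit.
Unset Printing Implicit Defensive.

Import Order.TTheory GRing.Theory Num.Theory.

Local Open Scope quotient_scope.
Local Open Scope classical_set_scope.
Local Open Scope ring_scope.

Section Quotient.
Variables (T : Type) (r : T -> T -> Prop).

Definition gen_equiv : rel {classic T} :=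
  fun x y => `[< clos_refl_sym_trans T r x y >].

Lemma gen_equiv_refl : reflexive gen_equiv.
Proof. by move=> x; apply/asboolP; exact: rst_refl. Qed.

Lemma gen_equiv_sym : symmetric gen_equiv.
Proof.
by move=> x y; apply/idP/idP => /asboolP h; apply/asboolP; exact: rst_sym.
Qed.

Lemma gen_equiv_trans : transitive gen_equiv.
Proof.
by move=> y x z /asboolP xy /asboolP yz; apply/asboolP; exact: rst_trans xy yz.
Qed.

Canonical gen_equiv_equiv :=
  EquivRel gen_equiv gen_equiv_refl gen_equiv_sym gen_equiv_trans.

Definition quot : Type := {eq_quot gen_equiv}.

Definition qpi (x : T) : quot := \pi_({eq_quot gen_equiv}) (x : {classic T}).

Definition qrepr (q : quot) : T := repr (q : {eq_quot gen_equiv}).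

Lemma qreprK q : qpi (qrepr q) = q.
Proof. by rewrite /qpi /qrepr reprK. Qed.

Lemma qpiP x y : qpi x = qpi y <-> clos_refl_sym_trans T r x y.
Proof. by split=> [/eqquotP/asboolP|h] //; apply/eqquotP/asboolP. Qed.

(* The map on the quotient induced by f; it deserves this name only when f is
   compatible with r, which is then recorded by a lemma (see qliftE). *)
Definition qlift (U : Type) (f : T -> U) (q : quot) : U := f (qrepr q).

Lemma qliftE (U : Type) (f : T -> U) :
  (forall x y, r x y -> f x = f y) -> forall x, qlift f (qpi x) = f x.
Proof.
move=> fr x; rewrite /qlift.
have /qpiP h : qpi (qrepr (qpi x)) = qpi x by rewrite qreprK.
move: (qrepr _) h => y h.
by elim: h => [a b /fr|a|a b _|a b c _ -> _ ->].
Qed.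

Lemma qind (P : quot -> Prop) : (forall x, P (qpi x)) -> forall q, P q.
Proof. by move=> h q; rewrite -(qreprK q). Qed.

End Quotient.

Section Complexes.
Variable R : realType.

Definition simplex (k : nat) : Type :=
  {t : 'I_k.+1 -> R | (forall i, 0 <= t i) /\ \sum_i t i = 1}.

(* A complex is given, as a Delta-complex, by its set of points and by the
   characteristic maps of its cells.  The topology is the weak one (a set is
   open iff its preimages under all the characteristic maps are open), so it
   is not part of the data. *)
Record complex := Complex {
  point :> Type;
  cell : forall k, (simplex k -> point) -> Prop }.

Definition is_iso (C D : complex) (f : C -> D) : Prop :=
  bijective f /\
  forall k (s : simplex k -> C), cell s <-> @cell D k (f \o s).

Definition quot_complex (C : complex) (r : C -> C -> Prop) : complex :=
  @Complex (quot r)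
    (fun k s => exists2 s' : simplex k -> C, cell s' & s = qpi r \o s').

Definition prod_complex (C : complex) (X : Type) : complex :=
  @Complex (C * X)%type
    (fun k s => exists2 s' : simplex k -> C, cell s' &
                exists x, s = fun t => (s' t, x)).

End Complexes.

Section Realization.
Variables (R : realType) (V : Type).
Implicit Types (P : set (set V)) (w : set V -> R).

(* Barycentric coordinates: w A is the weight of the vertex A of the order
   complex of (P, inclusion). *)
Definition is_point P w : Prop :=
  [/\ forall A, 0 <= w A,
      finite_set [set A | w A != 0],
      forall A, w A != 0 -> P A,
      forall A B, w A != 0 -> w B != 0 -> A `<=` B \/ B `<=` A &
      \sum_(A \in setT) w A = 1].

Definition realization_point P : Type := {w : set V -> R | is_point P w}.

Definition weight P (xi : realization_point P) : set V -> R := sval xi.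

Definition realization P : complex R :=
  @Complex R (realization_point P)
    (fun k s => exists c : 'I_k.+1 -> set V,
       [/\ forall i, P (c i),
           forall i j : 'I_k.+1, (i < j)%N -> c i `<=` c j /\ c i <> c j &
           forall t A, weight (s t) A = \sum_(i | `[< c i = A >]) sval t i]).

Lemma weight_inj P : injective (@weight P).
Proof. by move=> [w pw] [w' pw'] /= h; exact: eq_exist. Qed.

End Realization.

Section Pushforward.
Variable R : realType.

Definition push (V V' : Type) (u : V -> V') (w : set V -> R) : set V' -> R :=
  fun B => \sum_(A \in [set A | u @` A = B]) w A.

Lemma push_seq (V V' : Type) (u : V -> V') (w : set V -> R)
    (s : seq (set V)) B :
  uniq s -> (forall A, w A != 0 -> A \in s) ->
  push u w B = \sum_(A <- s | u @` A == B) w A.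
Proof.
move=> us hs; rewrite /push.
have -> : [set A | u @` A = B] = [set` [pred A | u @` A == B]].
  by apply/seteqP; split=> A /= /eqP.
apply/esym/bigfs => // A _; apply: contraNeq; exact: hs.
Qed.

Definition supp (V : Type) (w : set V -> R) : seq (set V) :=
  finmap.enum_fset (fset_set [set A | w A != 0]).

Lemma suppP (V : Type) (w : set V -> R) :
  finite_set [set A | w A != 0] -> forall A, (A \in supp w) = (w A != 0).
Proof.
move=> fw A; rewrite /supp in_fset_set //.
by apply/idP/idP; rewrite inE.
Qed.

Lemma supp_uniq (V : Type) (w : set V -> R) : uniq (supp w).
Proof. exact: finmap.fset_uniq. Qed.

Lemma pushE (V V' : Type) (u : V -> V') (w : set V -> R) :
  finite_set [set A | w A != 0] ->
  push u w = fun B => \sum_(A <- supp w | u @` A == B) w A.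
Proof.
move=> fw; apply/funext => B; apply: push_seq; first exact: supp_uniq.
by move=> A; rewrite suppP.
Qed.

Lemma push_ge0 (V V' : Type) (u : V -> V') (w : set V -> R) :
  (forall A, 0 <= w A) -> forall B, 0 <= push u w B.
Proof. by move=> w0 B; apply: fsumr_ge0. Qed.

Lemma push_neq0 (V V' : Type) (u : V -> V') (w : set V -> R) B :
  push u w B != 0 -> exists2 A, w A != 0 & u @` A = B.
Proof.
move=> h; apply: contrapT => nA; move/eqP: h; apply.
apply: fsbig1 => A uA; apply/eqP/negPn/negP => wA; apply: nA.
by exists A.
Qed.

Lemma push_finite (V V' : Type) (u : V -> V') (w : set V -> R) :
  finite_set [set A | w A != 0] -> finite_set [set B | push u w B != 0].
Proof.
move=> fw; apply: (@sub_finite_set _ _ ((fun A => u @` A) @` [set A | w A != 0])).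
  by move=> B /= /push_neq0 [A wA <-]; exists A.
exact: finite_image.
Qed.

Lemma push_sum (V V' : Type) (u : V -> V') (w : set V -> R)
    (D : pred (set V')) :
  finite_set [set A | w A != 0] ->
  \sum_(B \in [set` D]) push u w B = \sum_(A <- supp w | D (u @` A)) w A.
Proof.
move=> fw; pose t := undup [seq u @` A | A <- supp w].
rewrite -(@bigfs _ _ _ _ t) ?undup_uniq //; last first.
  move=> B _; apply: contraNeq => /push_neq0 [A wA <-].
  by rewrite mem_undup; apply: map_f; rewrite suppP.
rewrite pushE // (eq_bigr (fun B => \sum_(A <- supp w | D (u @` A) &&
  (u @` A == B)) w A)); last first.
  by move=> B DB; apply: eq_bigl => A; case: eqP => [->|_]; rewrite ?DB ?andbF.
rewrite (exchange_big_dep (fun A => D (u @` A))) /=; last by move=> ? ? _ /andP[].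
rewrite big_seq_cond [RHS]big_seq_cond; apply: eq_bigr => A /andP[sA DA].
rewrite (eq_bigl (pred1 (u @` A))); last first.
  by move=> B /=; rewrite DA eq_sym; case: eqP => [->|]; rewrite ?DA ?andbF.
rewrite -big_filter filter_pred1_uniq ?undup_uniq ?big_seq1 //.
by rewrite mem_undup; apply: map_f.
Qed.

Lemma push_id (V : Type) (w : set V -> R) : push id w = w.
Proof.
apply/funext => B; rewrite /push (_ : [set A | id @` A = B] = [set B]).
  by rewrite fsbig_set1.
by apply/seteqP; split=> A /=; rewrite image_id.
Qed.

Lemma push_comp (V1 V2 V3 : Type) (u : V1 -> V2) (v : V2 -> V3)
    (w : set V1 -> R) :
  finite_set [set A | w A != 0] -> push v (push u w) = push (v \o u) w.
Proof.
move=> fw; apply/funext => B.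
rewrite {1}/push (_ : [set A | v @` A = B] = [set` [pred A | v @` A == B]]).
  rewrite push_sum // pushE //; apply: eq_bigl => A /=.
  by rewrite image_comp.
by apply/seteqP; split=> A /= /eqP.
Qed.

Lemma push_is_point (V V' : Type) (u : V -> V') (P : set (set V))
    (Q : set (set V')) (w : set V -> R) :
  (forall A, P A -> Q (u @` A)) -> is_point P w -> is_point Q (push u w).
Proof.
move=> PQ [w0 fw Pw cw w1]; split.
- exact: push_ge0.
- exact: push_finite.
- by move=> B /push_neq0 [A /Pw /PQ QA <-].
- move=> _ _ /push_neq0 [A wA <-] /push_neq0 [B wB <-].
  by case: (cw A B wA wB) => AB; [left|right]; apply: image_subset.
- rewrite (_ : setT = [set` predT]); last by apply/seteqP; split.
  rewrite push_sum // -w1 (_ : setT = [set` predT]); last first.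
    by apply/seteqP; split.
  apply: bigfs; first exact: supp_uniq.
  by move=> A _; apply: contraNeq; rewrite suppP.
Qed.

Definition realization_map (V V' : Type) (u : V -> V') (P : set (set V))
    (Q : set (set V')) (PQ : forall A, P A -> Q (u @` A))
    (xi : realization R P) : realization R Q :=
  exist _ (push u (weight xi)) (push_is_point PQ (svalP xi)).

Lemma point_finite (V : Type) (P : set (set V)) (xi : realization R P) :
  finite_set [set A | weight xi A != 0].
Proof. by case: xi => w []. Qed.

End Pushforward.

Record bimodule (G : groupType) := Bimodule {
  bimodule_sort :> Type;
  lact : G -> bimodule_sort -> bimodule_sort;
  ract : bimodule_sort -> G -> bimodule_sort;
  lact1 : forall m, lact 1%g m = m;
  lactM : forall g h m, lact (g * h)%g m = lact g (lact h m);
  ract1 : forall m, ract m 1%g = m;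
  ractM : forall m g h, ract m (g * h)%g = ract (ract m g) h;
  lractA : forall g m h, ract (lact g m) h = lact g (ract m h) }.

(* A covering bimodule with a basis: the right action has finitely many orbits
   because the basis is indexed by a finite type. *)
Record selfSimilarGroup (G : groupType) := SelfSimilarGroup {
  ssg_bimodule :> bimodule G;
  ract_free : forall (m : ssg_bimodule) g, ract m g = m -> g = 1%g;
  letter : finType;
  basis : letter -> ssg_bimodule;
  basisP : forall m, exists! x, exists g, m = ract (basis x) g }.

Section SelfSimilar.
Variables (G : groupType) (S : selfSimilarGroup G).
Implicit Types (g h : G) (x : letter S) (m : S) (v : seq (letter S)).

Lemma coord_ex m : exists p : letter S * G, m = ract (basis p.1) p.2.
Proof. by have [x [[g mE] _]] := basisP m; exists (x, g). Qed.

Definition coord m : letter S * G := sval (cid (coord_ex m)).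

Lemma coordE m : ract (basis (coord m).1) (coord m).2 = m.
Proof. by rewrite /coord; case: cid. Qed.

Lemma ract_inj m g h : ract m g = ract m h -> g = h.
Proof.
move=> e; have gh : (g * h^-1)%g = 1%g.
  by apply: (@ract_free _ _ m); rewrite ractM e -ractM mulgV ract1.
by rewrite -[g](mulgK h^-1)%g gh mul1g invgK.
Qed.

Lemma coord_basis x g : coord (ract (basis x) g) = (x, g).
Proof.
set m := ract _ _; have [y [_ yu]] := basisP m.
have xE : (coord m).1 = x.
  rewrite -(yu x); last by exists g.
  by symmetry; apply: yu; exists (coord m).2; rewrite coordE.
have := coordE m; rewrite [coord m]surjective_pairing /= xE.
by move=> /ract_inj ->.
Qed.

(* g . x = act g x . sec g x, i.e. act g x is g(x) and sec g x is g|_x. *)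
Definition act g x : letter S := (coord (lact g (basis x))).1.
Definition sec g x : G := (coord (lact g (basis x))).2.

Lemma lact_basis g x : lact g (basis x) = ract (basis (act g x)) (sec g x).
Proof. by rewrite coordE. Qed.

Lemma coord_lact_basis g x h :
  coord (lact g (ract (basis x) h)) = (act g x, (sec g x * h)%g).
Proof. by rewrite -lractA lact_basis -ractM coord_basis. Qed.

Lemma coord_ract m g : coord (ract m g) = ((coord m).1, ((coord m).2 * g)%g).
Proof. by rewrite -[in LHS](coordE m) -ractM coord_basis. Qed.

Lemma coord_lact g m :
  coord (lact g m) = (act g (coord m).1, (sec g (coord m).1 * (coord m).2)%g).
Proof. by rewrite -[in LHS](coordE m) coord_lact_basis. Qed.

Lemma actM g h x : act (g * h)%g x = act g (act h x).
Proof. by rewrite {1}/act lactM lact_basis coord_lact_basis. Qed.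

Lemma secM g h x : sec (g * h)%g x = (sec g (act h x) * sec h x)%g.
Proof. by rewrite {1}/sec lactM lact_basis coord_lact_basis. Qed.

Lemma act1 x : act 1%g x = x.
Proof. by rewrite /act lact1 -[basis x]ract1 coord_basis. Qed.

Lemma sec1 x : sec 1%g x = 1%g.
Proof. by rewrite /sec lact1 -[basis x]ract1 coord_basis. Qed.

Lemma secV g x : sec g^-1%g (act g x) = (sec g x)^-1%g.
Proof.
by apply: (mulIg (sec g x)); rewrite -secM !mulVg sec1.
Qed.

(* g|_v: since g . (x (x) v) = g(x) (x) g|_x . v in the tensor powers, the
   section at a word is the iterated section at its letters. *)
Definition secw g v : G := foldl sec g v.

Definition self_replicating : Prop :=
  inhabited S /\ forall m m' : S, exists g, lact g m = m'.

Definition contracting_set (N : set G) : Prop :=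
  finite_set N /\
  forall g, exists n0, forall v, (n0 <= size v)%N -> N (secw g v).

Definition contracting : Prop := exists N, contracting_set N.

Definition is_nucleus (N : set G) : Prop :=
  contracting_set N /\ forall N', contracting_set N' -> N `<=` N'.

Lemma nucleus_sec N g x : is_nucleus N -> N g -> N (sec g x).
Proof.
move=> [[fN cN] minN]; suff: N `<=` [set h | N h /\ forall y, N (sec h y)].
  by move=> h /h [].
apply: minN; split; first by apply: sub_finite_set fN => h [].
move=> h; have [n0 hn] := cN h; exists n0 => v sv; split; first exact: hn.
move=> y; rewrite (_ : sec _ _ = secw h (rcons v y)).
  by apply: hn; rewrite size_rcons ltnW.
by rewrite /secw foldl_rcons.
Qed.

End SelfSimilar.

Definition finitely_generated (G : groupType) : Prop :=
  exists2 A : set G, finite_set A &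
    forall H : set G, A `<=` H -> H 1%g ->
      (forall g h, H g -> H h -> H (g * h)%g) ->
      (forall g, H g -> H g^-1%g) -> H = setT.

Record rcomplex (R : realType) (G : groupType) := RComplex {
  rcomplex_complex :> complex R;
  rtrans : rcomplex_complex -> G -> rcomplex_complex;
  rtrans1 : forall z, rtrans z 1%g = z;
  rtransM : forall z g h, rtrans z (g * h)%g = rtrans (rtrans z g) h }.

Section Tensor.
Variables (R : realType) (G : groupType) (Z : rcomplex R G) (M : bimodule G).

Definition tensor_rel (p q : prod_complex Z M) : Prop :=
  exists g, p.1 = rtrans q.1 g /\ q.2 = lact g p.2.

Definition tensor_complex : complex R := quot_complex tensor_rel.

Definition tens (z : Z) (m : M) : tensor_complex :=
  qpi tensor_rel (z, m).

Lemma tens_rtrans z g m : tens (rtrans z g) m = tens z (lact g m).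
Proof. by apply/qpiP; apply: rst_step; exists g. Qed.

Lemma tensor_ind (P : tensor_complex -> Prop) :
  (forall z m, P (tens z m)) -> forall t, P t.
Proof. by move=> h; apply: qind => -[z m]; exact: h. Qed.

Definition tlift (U : Type) (f : Z -> M -> U) : tensor_complex -> U :=
  qlift (fun p => f p.1 p.2).

Lemma tliftE (U : Type) (f : Z -> M -> U) :
  (forall z g m, f (rtrans z g) m = f z (lact g m)) ->
  forall z m, tlift f (tens z m) = f z m.
Proof.
move=> fr z m; apply: (@qliftE _ tensor_rel _ (fun p => f p.1 p.2)).
by move=> [z1 m1] [z2 m2] [g /= [-> ->]].
Qed.

Definition tensor_rtrans (t : tensor_complex) (g : G) : tensor_complex :=
  tlift (fun z m => tens z (ract m g)) t.

Lemma tensor_rtransE z m g : tensor_rtrans (tens z m) g = tens z (ract m g).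
Proof. by apply: tliftE => z' g' m'; rewrite tens_rtrans lractA. Qed.

Lemma tensor_rtrans1 t : tensor_rtrans t 1%g = t.
Proof. by elim/tensor_ind: t => z m; rewrite tensor_rtransE ract1. Qed.

Lemma tensor_rtransM t g h :
  tensor_rtrans t (g * h)%g = tensor_rtrans (tensor_rtrans t g) h.
Proof. by elim/tensor_ind: t => z m; rewrite !tensor_rtransE ractM. Qed.

Definition tensor : rcomplex R G :=
  RComplex tensor_rtrans1 tensor_rtransM.

End Tensor.

Section TilingNerve.
Variables (R : realType) (G : groupType) (S : selfSimilarGroup G) (N : set G).

(* The simplices of Gamma(G, N); they are finite as soon as N is. *)
Definition nerve_simplex (A : set G) : Prop :=
  A !=set0 /\ forall g h, A g -> A h -> N (g * h^-1)%g.

(* A is a simplex of I^(n)(Gamma(G, N) (x) M^(x)n) for every n. *)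
Definition adjacency (A : set G) : Prop :=
  forall n, exists B (v : seq (letter S)) h,
    [/\ nerve_simplex B, size v = n &
        A = (fun g => secw g v * h)%g @` B].

Lemma adjacency_trans (h : G) (A : set G) :
  adjacency A -> adjacency ((fun g => g * h)%g @` A).
Proof.
move=> adjA n; have [B [v [k [nB sv ->]]]] := adjA n.
exists B, v, (k * h)%g; split=> //; rewrite image_comp.
by apply: eq_imagel => g _ /=; rewrite mulgA.
Qed.

Lemma adjacency_sec (x : letter S) (h : G) (A : set G) :
  is_nucleus S N -> adjacency A ->
  adjacency ((fun g => sec g x * h)%g @` A).
Proof.
move=> nN adjA n; have [B [v [k [[B0 nB] sv ->]]]] := adjA n.
pose w := rcons v (act k x).
have [y [v' [wE sv']]] : exists y v', w = y :: v' /\ size v' = n.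
  rewrite -sv /w; case: (v) => [|z v0]; first by exists (act k x), [::].
  by exists z, (rcons v0 (act k x)); rewrite size_rcons.
exists [set sec b y | b in B], v', (sec k x * h)%g; split=> //.
  split; first by case: B0 => b Bb; exists (sec b y), b.
  move=> _ _ [a Ba <-] [b Bb <-].
  have := nucleus_sec (act b y) nN (nB _ _ Ba Bb).
  by rewrite secM -actM mulVg act1 secV.
rewrite !image_comp; apply: eq_imagel => b _ /=.
have -> : secw (sec b y) v' = secw b w by rewrite wE.
by rewrite secM mulgA /w /secw foldl_rcons.
Qed.

(* All complexes are realized through barycentric subdivisions: a point of the
   tiling nerve is a weight on a flag of adjacency subsets, and I_x is affine
   on the simplices of the subdivision, with A |-> A|_x on its vertices.  (The
   extension of g |-> g|_x that is affine on the simplices of the undivided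
   nerve need not map T_0 to T_0, as g |-> g|_x can identify vertices.) *)
Definition nerve_complex : complex R := realization R adjacency.

Definition nerve_rtrans (xi : nerve_complex) (g : G) : nerve_complex :=
  realization_map (@adjacency_trans g) xi.

Lemma nerve_rtrans1 xi : nerve_rtrans xi 1%g = xi.
Proof.
apply: weight_inj => /=; rewrite -[RHS]push_id; congr (push _ _).
by apply/funext => g; rewrite mulg1.
Qed.

Lemma nerve_rtransM xi g h :
  nerve_rtrans xi (g * h)%g = nerve_rtrans (nerve_rtrans xi g) h.
Proof.
apply: weight_inj => /=; rewrite push_comp; last exact: point_finite.
by congr (push _ _); apply/funext => k /=; rewrite mulgA.
Qed.

Definition nerve : rcomplex R G := RComplex nerve_rtrans1 nerve_rtransM.

(* Gamma_n, the tensor products being bracketed from the left. *)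
Fixpoint Gamma (n : nat) : rcomplex R G :=
  if n is n'.+1 then tensor (Gamma n') S else nerve.

Lemma Gamma_rtransE n (z : Gamma n) (m : S) g :
  rtrans (tens z m : Gamma n.+1) g = tens z (ract m g).
Proof. exact: tensor_rtransE. Qed.

(* xi (x) m_0 (x) ... (x) m_(n-1) *)
Fixpoint pure_tensor (n : nat) (xi : nerve) (m : nat -> S) : Gamma n :=
  if n is n'.+1 then tens (pure_tensor n' xi m) (m n') else xi.

Definition orbit_rel (Z : rcomplex R G) (z z' : Z) : Prop :=
  exists g, z' = rtrans z g.

Definition J (n : nat) : complex R := quot_complex (@orbit_rel (Gamma n)).

Definition to_J (n : nat) (z : Gamma n) : J n := qpi (@orbit_rel (Gamma n)) z.

Lemma to_J_rtrans n (z : Gamma n) g : to_J (rtrans z g) = to_J z.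
Proof. by apply/esym/qpiP; apply: rst_step; exists g. Qed.

Definition p_J (n : nat) : J n.+1 -> J n :=
  qlift (tlift (fun (z : Gamma n) (m : S) => to_J z)).

Lemma p_J_tens n (z : Gamma n) (m : S) :
  p_J (to_J (tens z m : Gamma n.+1)) = to_J z.
Proof.
have lE (z' : Gamma n) (m' : S) :
    tlift (fun (z : Gamma n) (m : S) => to_J z) (tens z' m') = to_J z'.
  by apply: tliftE => z1 g m1; rewrite to_J_rtrans.
rewrite /p_J /to_J qliftE // => z1 _ [g ->].
elim/tensor_ind: z1 => z1 m1.
by rewrite Gamma_rtransE !lE.
Qed.

Lemma p_J_pure n xi m :
  p_J (to_J (pure_tensor n.+1 xi m)) = to_J (pure_tensor n xi m).
Proof. exact: p_J_tens. Qed.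

Section Iota.
Hypothesis nN : is_nucleus S N.

(* I(xi (x) x . h) = I_x(xi) . h. *)
Definition I_point (xi : nerve) (m : S) : nerve :=
  realization_map
    (fun A => @adjacency_sec (coord m).1 (coord m).2 A nN) xi.

Lemma I_point_lact xi g m :
  I_point (rtrans xi g) m = I_point xi (lact g m).
Proof.
apply: weight_inj => /=; rewrite push_comp; last exact: point_finite.
congr (push _ _); apply/funext => h /=.
by rewrite coord_lact /= secM mulgA.
Qed.

Lemma I_point_ract xi m g :
  I_point xi (ract m g) = rtrans (I_point xi m) g.
Proof.
apply: weight_inj => /=; rewrite push_comp; last exact: point_finite.
congr (push _ _); apply/funext => h /=.
by rewrite coord_ract /= mulgA.
Qed.

(* I (x) id : Gamma (x) M (x) M^(x)n -> Gamma (x) M^(x)n. *)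
Fixpoint I_tensor (n : nat) : Gamma n.+1 -> Gamma n :=
  match n return Gamma n.+1 -> Gamma n with
  | 0 => tlift I_point
  | n'.+1 => tlift (fun (z : Gamma n'.+1) (m : S) => tens (I_tensor z) m)
  end.

Arguments I_tensor n z : clear implicits.

Lemma I_tensor0 xi (m : S) : I_tensor 0 (tens xi m) = I_point xi m.
Proof. by apply: tliftE => *; exact: I_point_lact. Qed.

Lemma I_tensorS_rtrans n :
  (forall (z : Gamma n.+1) (m : S),
     I_tensor n.+1 (tens z m) = tens (I_tensor n z) m) /\
  (forall (z : Gamma n.+1) g,
     I_tensor n (rtrans z g) = rtrans (I_tensor n z) g).
Proof.
elim: n => [|n [IH1 IH2]].
  have e2 (z : Gamma 1) g : I_tensor 0 (rtrans z g) = rtrans (I_tensor 0 z) g.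
    elim/tensor_ind: z => xi m.
    by rewrite Gamma_rtransE !I_tensor0 I_point_ract.
  split=> // z m; apply: tliftE => z1 g m1.
  exact: etrans (congr1 (fun w => tens w m1) (e2 z1 g)) (tens_rtrans _ _ _).
have e2 (z : Gamma n.+2) g :
    I_tensor n.+1 (rtrans z g) = rtrans (I_tensor n.+1 z) g.
  elim/tensor_ind: z => z m.
  by rewrite Gamma_rtransE !IH1 Gamma_rtransE.
split=> // z m; apply: tliftE => z1 g m1.
exact: etrans (congr1 (fun w => tens w m1) (e2 z1 g)) (tens_rtrans _ _ _).
Qed.

Lemma I_tensorS n (z : Gamma n.+1) (m : S) :
  I_tensor n.+1 (tens z m) = tens (I_tensor n z) m.
Proof. by have [] := I_tensorS_rtrans n. Qed.

Lemma I_tensor_rtrans n (z : Gamma n.+1) g :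
  I_tensor n (rtrans z g) = rtrans (I_tensor n z) g.
Proof. by have [] := I_tensorS_rtrans n. Qed.

Lemma I_tensor_pure n xi m :
  I_tensor n (pure_tensor n.+1 xi m) =
  pure_tensor n (I_point xi (m 0)) (fun i => m i.+1).
Proof.
elim: n => [|n IH]; first exact: I_tensor0.
by rewrite [pure_tensor n.+2 _ _]/= I_tensorS IH.
Qed.

Definition iota_J (n : nat) : J n.+1 -> J n :=
  qlift (fun z : Gamma n.+1 => to_J (I_tensor n z)).

Lemma iota_J_pure n xi m :
  iota_J (to_J (pure_tensor n.+1 xi m)) =
  to_J (pure_tensor n (I_point xi (m 0)) (fun i => m i.+1)).
Proof.
rewrite /iota_J /to_J qliftE ?I_tensor_pure // => z _ [g ->].
by rewrite I_tensor_rtrans; apply/esym; exact: to_J_rtrans.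
Qed.

End Iota.

(* A complex with subcomplexes K_g and partial maps kappa_g, each given by its
   graph; only the indices g in N \ {1} are relevant. *)
Record stage := Stage {
  stage_complex :> complex R;
  stage_K : G -> set stage_complex;
  stage_kappa : G -> stage_complex -> stage_complex -> Prop }.

Definition pointed_adjacency (A : set G) : Prop := adjacency A /\ A 1%g.

Definition T0_complex : complex R := realization R pointed_adjacency.

Definition K0 (g : G) : set T0_complex :=
  [set xi | forall A, weight xi A != 0 -> A g].

Definition kappa0 (g : G) (xi xi' : T0_complex) : Prop :=
  K0 g xi /\ weight xi' = push (fun h => h * g^-1)%g (weight xi).

Definition stage0 : stage := Stage K0 kappa0.

Section NextStage.
Variable T : stage.

Definition next_rel (p q : prod_complex T (letter S)) : Prop :=
  exists g, [/\ N g, g <> 1%g & sec g p.2 = 1%g] /\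
    [/\ stage_K g p.1, stage_kappa g p.1 q.1 & q.2 = act g p.2].

Definition next_complex : complex R := quot_complex next_rel.

Definition next_point (xi : T) (x : letter S) : next_complex :=
  qpi next_rel (xi, x).

Definition next_K (g : G) : set next_complex :=
  [set t | exists h xi x, [/\ N h, sec h x = g, stage_K h xi &
                              t = next_point xi x]].

Definition next_kappa (g : G) (t t' : next_complex) : Prop :=
  exists h xi x xi', [/\ N h, sec h x = g & stage_K h xi] /\
    [/\ stage_kappa h xi xi', t = next_point xi x &
        t' = next_point xi' (act h x)].

Definition next_stage : stage := Stage next_K next_kappa.

Definition kappa_rel (t t' : T) : Prop :=
  exists g, [/\ N g, g <> 1%g, stage_K g t & stage_kappa g t t'].

Definition kappa_quotient : complex R := quot_complex kappa_rel.

Definition to_kappa_quotient (t : T) : kappa_quotient := qpi kappa_rel t.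

End NextStage.

Fixpoint T (n : nat) : stage :=
  if n is n'.+1 then next_stage (T n') else stage0.

Definition T_point (n : nat) (xi : T n) (x : letter S) : T n.+1 :=
  next_point xi x.

Lemma T0_adjacency (A : set G) :
  pointed_adjacency A -> adjacency (id @` A).
Proof. by case; rewrite image_id. Qed.

Definition T0_incl (xi : T 0) : Gamma 0 := realization_map T0_adjacency xi.

Lemma I_T0_adjacency (x : letter S) (nN : is_nucleus S N) (A : set G) :
  pointed_adjacency A -> pointed_adjacency ((fun g => sec g x) @` A).
Proof.
move=> [adjA A1]; split; last by exists 1%g => //; exact: sec1.
have := adjacency_sec x 1%g nN adjA; congr adjacency.
by apply: eq_imagel => g _; rewrite mulg1.
Qed.

Definition I_T0 (nN : is_nucleus S N) (x : letter S) (xi : T 0) : T 0 :=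
  realization_map (fun A => @I_T0_adjacency x nN A) xi.

End TilingNerve.

(* Main.v *)
Require Import Defs.
From Stdlib Require Import Relation_Operators.
From mathcomp Require Import all_boot all_order all_algebra.
From mathcomp Require Import boolp classical_sets functions cardinality fsbigop.
From mathcomp Require Import reals.

Set Implicit Arguments.
Unset Strict Implicit.
Unset Printing Implicit Defensive.

Import Order.TTheory GRing.Theory Num.Theory.
Local Open Scope classical_set_scope.
Local Open Scope ring_scope.

(** The complex [T n] is a fundamental domain in disguise.  The rule
    [(xi, x) |-> xi (x) x] defines inductively a map
    [tile_incl : T n -> Gamma n], and the theorem holds because this map is
    injective, because its image meets every right [G]-orbit, and because the
    overlaps of the image with its translates are exactly what the sets [K_g]
    and the maps [kappa_g] record:
      [tile_incl xi = tile_incl xi' . g]  iff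
      [g] is in [N], [xi] is in [K_g] and [kappa_g xi = xi'].
    At level 0, a point [xi . g^-1] of a translate of [T_0] lies in [T_0] iff
    [g] belongs to all the adjacency sets that support [xi]; as these sets also
    contain 1, such a [g] is in the nucleus.  From level [n] to level [n + 1],
    [xi (x) x = xi' (x) y . g] means that some [h] satisfies [xi = xi' . h] and
    [h . x = y . g], that is [h(x) = y] and [h|_x = g]; the level [n] overlaps
    then force [h] to be in [N], whence [g] is in [N], and these equations are
    the definition of [kappa_(g,n+1)].  For [g = 1] they are the
    identifications that define [T (n + 1)], which gives injectivity.

    All these properties are gathered in [fundamental_domain], proved for
    [stage0] and transported by [fundamental_domain_next].  They identify the
    quotient of [T n] by the [kappa_g] with the orbit complex [J n]
    ([domain_quotient_iso]).  The map [iota_n] on [T (n + 1)] is the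
    restriction of [I (x) id], which preserves the images of the [T n]; by
    injectivity it is well defined and satisfies the recursion. *)

(** * Equality in tensor products and orbit spaces *)

Lemma qpi_equivP (T : Type) (r : T -> T -> Prop) :
  (forall x, r x x) -> (forall x y, r x y -> r y x) ->
  (forall x y z, r x y -> r y z -> r x z) ->
  forall x y, qpi r x = qpi r y <-> r x y.
Proof.
move=> rr rs rt x y; split=> [/qpiP|rxy]; last by apply/qpiP; exact: rst_step.
by elim=> // [a b _ /rs|a b c _ ab _ bc] //; exact: rt ab bc.
Qed.

Section Equality.
Variables (R : realType) (G : groupType).

Lemma rtransK (Z : rcomplex R G) (z : Z) g : rtrans (rtrans z g) g^-1%g = z.
Proof. by rewrite -rtransM mulgV rtrans1. Qed.

Lemma tens_eqP (Z : rcomplex R G) (M : bimodule G) (z z' : Z) (m m' : M) :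
  tens z m = tens z' m' <-> exists g, z = rtrans z' g /\ m' = lact g m.
Proof.
apply: (qpi_equivP (r := @tensor_rel R G Z M)).
- by move=> [a b]; exists 1%g; rewrite rtrans1 lact1.
- move=> [a b] [c d] [g /= [-> ->]]; exists g^-1%g => /=.
  by rewrite rtransK -lactM mulVg lact1.
- move=> [a b] [c d] [e f] [g /= [-> ->]] [h /= [-> ->]]; exists (h * g)%g.
  by rewrite /= rtransM lactM.
Qed.

Lemma orbit_eqP (Z : rcomplex R G) (z z' : Z) :
  qpi (@orbit_rel R G Z) z = qpi (@orbit_rel R G Z) z' <->
  exists g, z' = rtrans z g.
Proof.
apply: (qpi_equivP (r := @orbit_rel R G Z)).
- by move=> x; exists 1%g; rewrite rtrans1.
- by move=> x y [g ->]; exists g^-1%g; rewrite rtransK.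
- by move=> x y z1 [g ->] [h ->]; exists (g * h)%g; rewrite rtransM.
Qed.

End Equality.

(** * Fundamental domains *)

Section Domain.
Variables (R : realType) (G : groupType) (S : selfSimilarGroup G) (N : set G).

(** The last two clauses are lifting properties: on points they say that the
    translates of the image cover [Z], on cells that each cell lies in a single
    translate, with no need to subdivide it. *)
Record fundamental_domain (T : stage R G) (Z : rcomplex R G) (f : T -> Z) :
    Prop := FundamentalDomain {
  domain_inj : injective f;
  domain_overlap : forall xi xi' g,
    f xi = rtrans (f xi') g <->
    [/\ N g, stage_K g xi & stage_kappa g xi xi'];
  domain_kappa : forall g (xi : T), stage_K g xi ->
    exists xi' : T, stage_kappa g xi xi';
  domain_cell : forall k (s : simplex R k -> T), cell s ->
    @cell R Z k (f \o s);
  domain_cover : forall z, exists xi g, z = rtrans (f xi) g;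
  domain_cover_cell : forall k (s : simplex R k -> Z), cell s ->
    exists (s' : simplex R k -> T) g,
      cell s' /\ s = fun t => rtrans (f (s' t)) g }.

Section Quotient.
Variables (T : stage R G) (Z : rcomplex R G) (f : T -> Z).
Hypothesis domf : fundamental_domain f.

Definition domain_quotient :
    kappa_quotient N T -> quot_complex (@orbit_rel R G Z) :=
  qlift (fun xi => qpi (@orbit_rel R G Z) (f xi)).

Lemma domain_quotientE xi :
  domain_quotient (to_kappa_quotient N xi) = qpi (@orbit_rel R G Z) (f xi).
Proof.
apply: qliftE => {}xi xi' [g [Ng _ Kg kg]].
have /(domain_overlap domf) -> : [/\ N g, stage_K g xi & stage_kappa g xi xi'].
  by [].
by apply/esym/orbit_eqP; exists g.
Qed.

Lemma domain_quotient_inj : injective domain_quotient.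
Proof.
elim/qind => xi; elim/qind => xi'; rewrite !domain_quotientE.
move=> /esym/orbit_eqP [g fg].
have [g1|g1] := pselect (g = 1%g).
  by congr qpi; apply: (domain_inj domf); rewrite fg g1 rtrans1.
have [Ng Kg kg] := (domain_overlap domf _ _ _).1 fg.
by apply/qpiP/rst_step; exists g.
Qed.

Lemma domain_quotient_iso : is_iso domain_quotient.
Proof.
split.
  rewrite -setTT_bijective; split=> //.
    by move=> ? ? _ _; exact: domain_quotient_inj.
  elim/qind => z _; have [xi [g ->]] := domain_cover domf z.
  exists (to_kappa_quotient N xi) => //; rewrite domain_quotientE.
  by apply/orbit_eqP; exists g.
move=> k s; split=> [[s' cs' ->]|[s' cs' sE]].
  exists (f \o s'); first exact: (domain_cell domf).
  by apply/funext => t; exact: domain_quotientE.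
have [s1 [g [cs1 s'E]]] := domain_cover_cell domf cs'.
exists s1 => //; apply/funext => t; apply: domain_quotient_inj.
rewrite [RHS]domain_quotientE; have /= -> := congr1 (@^~ t) sE.
by rewrite s'E; apply/esym/orbit_eqP; exists g.
Qed.

End Quotient.

Section Next.
Hypothesis nN : is_nucleus S N.
Variables (T : stage R G) (Z : rcomplex R G) (f : T -> Z).
Hypothesis domf : fundamental_domain f.

Definition next_map : next_stage S N T -> tensor Z S :=
  qlift (fun p => tens (f p.1) (basis p.2)).

Lemma next_mapE xi (x : letter S) :
  next_map (next_point N xi x) = tens (f xi) (basis x).
Proof.
apply: (@qliftE _ (@next_rel R G S N T) _ (fun p => tens (f p.1) (basis p.2))).
move=> [a y] [b z] [g [/= [Ng _ gy] [Kg kg ->]]].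
apply/tens_eqP; exists g; split; first by apply/(domain_overlap domf).
by rewrite lact_basis gy ract1.
Qed.

Lemma next_ind (P : next_stage S N T -> Prop) :
  (forall xi x, P (next_point N xi x)) -> forall t, P t.
Proof. by move=> h; apply: qind => -[xi x]; exact: h. Qed.

(** The equation [h . x = y . g] in the bimodule says that [h] sends [x] to [y]
    with section [g]. *)
Lemma tens_basis_eqP (z z' : Z) (x y : letter S) g :
  tens z (basis x) = tens z' (ract (basis y) g) <->
  exists h, [/\ z = rtrans z' h, y = act h x & g = sec h x].
Proof.
rewrite tens_eqP; split=> [[h [-> /(congr1 (@Defs.coord _ _))]]|[h [-> -> ->]]].
  by rewrite lact_basis 2!Defs.coord_basis => -[-> ->]; exists h.
by exists h; rewrite lact_basis.
Qed.

Lemma next_overlap (t t' : next_stage S N T) g :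
  next_map t = rtrans (next_map t') g <->
  [/\ N g, stage_K g t & stage_kappa g t t'].
Proof.
split.
  elim/next_ind: t => xi x; elim/next_ind: t' => xi' y.
  rewrite !next_mapE [rtrans _ _]tensor_rtransE => /tens_basis_eqP.
  move=> [h [/(domain_overlap domf) [Nh Kh kh] -> ->]]; split.
  - exact: nucleus_sec.
  - by exists h, xi, x.
  - by exists h, xi, x, xi'.
move=> [_ _ [h [xi [x [xi' [[Nh <- Kh] [kh -> ->]]]]]]].
rewrite !next_mapE [rtrans _ _]tensor_rtransE; apply/tens_basis_eqP.
by exists h; split=> //; apply/(domain_overlap domf).
Qed.

Lemma next_map_inj : injective next_map.
Proof.
elim/next_ind => xi x; elim/next_ind => xi' y; rewrite !next_mapE.
rewrite -[basis y]ract1 => /tens_basis_eqP [h [fE -> hx]].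
have [h1|h1] := pselect (h = 1%g).
  rewrite h1 act1; congr (next_point _ _ x); apply: (domain_inj domf).
  by rewrite fE h1 rtrans1.
have [Nh Kh kh] := (domain_overlap domf _ _ _).1 fE.
by apply/qpiP/rst_step; exists h.
Qed.

Lemma fundamental_domain_next : fundamental_domain next_map.
Proof.
split.
- exact: next_map_inj.
- exact: next_overlap.
- move=> _ _ [h [xi [x [Nh <- Kh ->]]]].
  have [xi' kh] := domain_kappa domf Kh.
  by exists (next_point N xi' (act h x)), h, xi, x, xi'.
- move=> k _ [_ [s cs [x ->]] ->]; exists (fun t => (f (s t), basis x)).
    by exists (f \o s); [exact: (domain_cell domf)|exists (basis x)].
  by apply/funext => t; exact: next_mapE.
- elim/tensor_ind => z m; have [xi [g ->]] := domain_cover domf z.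
  exists (next_point N xi (Defs.coord (lact g m)).1), (Defs.coord (lact g m)).2.
  by rewrite next_mapE [RHS]tensor_rtransE coordE tens_rtrans.
- move=> k _ [_ [s cs [m ->]] ->].
  have [s' [g [cs' ->]]] := domain_cover_cell domf cs.
  exists (fun t => next_point N (s' t) (Defs.coord (lact g m)).1).
  exists (Defs.coord (lact g m)).2; split.
    exists (fun t => (s' t, (Defs.coord (lact g m)).1)) => //.
    by exists s' => //; exists (Defs.coord (lact g m)).1.
  apply/funext => t; rewrite next_mapE [RHS]tensor_rtransE coordE.
  exact: tens_rtrans.
Qed.

End Next.
End Domain.

(** * The initial stage *)

Lemma image_mulgK (G : groupType) (g : G) (A : set G) :
  (fun h => h * g^-1)%g @` ((fun h => h * g)%g @` A) = A.
Proof.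
rewrite image_comp (_ : _ \o _ = id) ?image_id //.
by apply/funext => h /=; rewrite mulgK.
Qed.

Lemma image_mulgVK (G : groupType) (g : G) (A : set G) :
  (fun h => h * g)%g @` ((fun h => h * g^-1)%g @` A) = A.
Proof. by rewrite -[in X in X @` (_ @` _)](invgK g) image_mulgK. Qed.

Lemma push_mulg (R : realType) (G : groupType) (g : G) (w : set G -> R) A :
  push (fun h => h * g)%g w A = w ((fun h => h * g^-1)%g @` A).
Proof.
rewrite /push (_ : [set B | _] = [set (fun h => h * g^-1)%g @` A]).
  by rewrite fsbig_set1.
apply/seteqP; split=> B /=; first by move=> <-; rewrite image_mulgK.
by move=> ->; rewrite image_mulgVK.
Qed.

(** A finite chain of non-empty sets has a smallest member, and any element of
    that member is common to all.  This turns a flag of the nerve into a choice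
    of a translate of [T_0] that contains it. *)
Lemma chain_common (V : Type) (v0 : V) (s : seq (set V)) :
  (forall A, A \in s -> A !=set0) ->
  (forall A B, A \in s -> B \in s -> A `<=` B \/ B `<=` A) ->
  exists v, forall A, A \in s -> A v.
Proof.
elim: s => [|A s IH] s0 sc; first by exists v0.
have [|B C sB sC|v sv] := IH.
- by move=> B sB; apply: s0; rewrite inE sB orbT.
- by apply: sc; rewrite inE ?sB ?sC orbT.
have [[B sB BA]|noB] := pselect (exists2 B, B \in s & B `<=` A).
  exists v => C; rewrite inE => /predU1P[->|/sv //].
  by apply: BA; exact: sv.
have [a Aa] := s0 A (mem_head A s).
exists a => C; rewrite inE => /predU1P[-> //|sC].
have [AC|CA] := sc A C (mem_head A s) (mem_behead (s := A :: s) sC).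
  exact: AC.
by case: noB; exists C.
Qed.

Section InitialStage.
Variables (R : realType) (G : groupType) (S : selfSimilarGroup G) (N : set G).

Lemma adjacency_neq0 A : adjacency S N A -> A !=set0.
Proof.
move=> /(_ 0%N) [B [v [h [[[b Bb] _] _ ->]]]].
by exists (secw b v * h)%g, b.
Qed.

Lemma adjacency_nucleus A g h : adjacency S N A -> A g -> A h -> N (g * h^-1)%g.
Proof.
move=> /(_ 0%N) [B [v [k [[_ nB] /size0nil -> ->]]]] [b Bb <-] [c Bc <-].
by rewrite invgM mulgA mulgK; exact: nB.
Qed.

Lemma weight_T0_incl (xi : T R S N 0) : weight (T0_incl xi) = weight xi.
Proof. exact: push_id. Qed.

Lemma weight_rtrans (xi : nerve R S N) g A :
  weight (rtrans xi g) A = weight xi ((fun h => h * g^-1)%g @` A).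
Proof. exact: push_mulg. Qed.

Lemma weight_neq0 (V : Type) (P : set (set V)) (xi : realization R P) A :
  weight xi A != 0 -> P A.
Proof. by case: xi => w [] /= _ _ Pw _ _; exact: Pw. Qed.

Lemma pointed_adjacencyV A g :
  adjacency S N A -> A g ->
  pointed_adjacency S N ((fun h => h * g^-1)%g @` A).
Proof.
by move=> adjA Ag; split; [exact: adjacency_trans|exists g; rewrite ?mulgV].
Qed.

(** Translating a flag all of whose sets contain [g] by [g^-1] makes them
    contain 1.  With [P] the pointed adjacency sets this gives the target of
    [kappa_(g,0)]; with [P] all the adjacency sets it moves any point of the
    nerve into [T_0]. *)
Lemma T0_translate (P : set (set G)) (xi : realization R P) g :
  P `<=` adjacency S N -> (forall A, weight xi A != 0 -> A g) ->
  exists xi' : T R S N 0, weight xi' = push (fun h => h * g^-1)%g (weight xi).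
Proof.
move=> Padj xig.
have pxi : is_point [set A | P A /\ A g] (weight xi).
  have := svalP xi; rewrite /weight in xig * => -[w0 fw Pw cw w1]; split=> //.
  by move=> A wA; split; [exact: Pw|exact: xig].
have PQ A : [set A | P A /\ A g] A ->
    pointed_adjacency S N ((fun h => h * g^-1)%g @` A).
  by move=> [/Padj adjA Ag]; exact: pointed_adjacencyV.
by exists (exist _ _ (push_is_point PQ pxi)).
Qed.

Lemma T0_overlap (xi xi' : T R S N 0) g :
  T0_incl xi = rtrans (T0_incl xi' : nerve R S N) g <->
  [/\ N g, stage_K g xi & stage_kappa g xi xi'].
Proof.
split=> [e|[_ _ [_ e]]]; last first.
  apply: weight_inj; apply/funext => A.
  by rewrite weight_rtrans !weight_T0_incl e push_mulg invgK image_mulgVK.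
have wE A : weight xi A = weight xi' ((fun h => h * g^-1)%g @` A).
  by rewrite -weight_T0_incl e weight_rtrans weight_T0_incl.
have Kg : K0 g xi.
  move=> A; rewrite wE => /weight_neq0 [_ [h Ah /(congr1 (fun k => k * g)%g)]].
  by rewrite mulgVK mul1g => <-.
split=> //; last first.
  by split=> //; apply/funext => A; rewrite push_mulg wE invgK image_mulgK.
(* A flag of weight 1 is not empty: some set of the support contains 1 and g. *)
have [A wA] : exists A, weight xi A != 0.
  apply: contrapT => nA; case: (xi) nA => w [] /= _ _ _ _ w1 nA.
  move: w1; rewrite fsbig1 => [/eqP|A _]; first by rewrite eq_sym oner_eq0.
  by apply/eqP/negPn/negP => wA; apply: nA; exists A.
have [adjA A1] := weight_neq0 wA.
by rewrite -[g]mulg1 -invg1; apply: (adjacency_nucleus adjA) => //; exact: Kg.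
Qed.

Lemma fundamental_domain0 :
  @fundamental_domain R G N (stage0 R S N) (nerve R S N) (@T0_incl R G S N).
Proof.
split.
- move=> xi xi' e; apply: weight_inj.
  by rewrite -!weight_T0_incl e.
- exact: T0_overlap.
- move=> g xi Kg; have [|xi' e] := T0_translate (P := pointed_adjacency S N) _ Kg.
    by move=> A [].
  by exists xi'.
- move=> k s [c [cP cc cw]]; exists c; split=> //.
    by move=> i; have [] := cP i.
  by move=> t A; rewrite -cw; congr (_ A); exact: weight_T0_incl.
- move=> z; have fz := point_finite z.
  have [|A B|g zg] := chain_common 1%g (s := supp (weight z)).
  + by move=> A; rewrite suppP // => /weight_neq0/adjacency_neq0.
  + rewrite !suppP //; case: (z) => w [] /= _ _ _ cw _; exact: cw.
  have [//|A|xi e] := T0_translate (xi := z) (g := g).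
    by rewrite -suppP //; exact: zg.
  exists xi, g; apply: weight_inj; apply/funext => A.
  by rewrite weight_rtrans weight_T0_incl e push_mulg invgK image_mulgVK.
- move=> k s [c [cP cc cw]].
  (* An element of the smallest set of the flag belongs to all of them. *)
  have [g c0g] := adjacency_neq0 (cP ord0).
  have cg i : c i g.
    have [i0|] := posnP i; first by rewrite (_ : i = ord0) //; exact: val_inj.
    by move=> /(cc ord0) [c0i _]; exact: c0i.
  have sg t A : weight (s t) A != 0 -> A g.
    rewrite cw => wA; have [[i ci]|nc] := pselect (exists i, c i = A).
      by rewrite -ci.
    move: wA; rewrite big_pred0 ?eqxx // => i.
    by apply/asboolP => ci; apply: nc; exists i.
  have [s' s'E] := choice (fun t => T0_translate (@subset_refl _ _) (sg t)).
  exists s', g; split.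
    exists (fun i => (fun h => h * g^-1)%g @` c i); split.
    + by move=> i; exact: pointed_adjacencyV.
    + move=> i j ij; have [cij nij] := cc i j ij; split.
        exact: image_subset.
      move=> e; apply: nij.
      by rewrite -(image_mulgVK g (c i)) e image_mulgVK.
    + move=> t A; rewrite s'E push_mulg invgK cw; apply: eq_bigl => i.
      by apply/asboolP/asboolP => [->|<-]; rewrite ?image_mulgVK ?image_mulgK.
  apply/funext => t; apply: weight_inj; apply/funext => A.
  by rewrite weight_rtrans weight_T0_incl s'E push_mulg invgK image_mulgVK.
Qed.

End InitialStage.

(** * The complexes [T n] inside the tensor powers of the tiling nerve *)

Section Tiles.
Variables (R : realType) (G : groupType) (S : selfSimilarGroup G) (N : set G).
Hypothesis nN : is_nucleus S N.

Fixpoint tile_incl (n : nat) : T R S N n -> Gamma R S N n :=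
  match n return T R S N n -> Gamma R S N n with
  | 0 => @T0_incl R G S N
  | n'.+1 => next_map (@tile_incl n')
  end.

Lemma tile_domain n : fundamental_domain N (@tile_incl n).
Proof.
elim: n => [|n IH]; first exact: fundamental_domain0.
exact: fundamental_domain_next.
Qed.

Lemma tile_inclS n (xi : T R S N n) x :
  tile_incl (T_point xi x) = tens (tile_incl xi) (basis x).
Proof. exact: (next_mapE (tile_domain n)). Qed.

Lemma I_point_basis (xi : T R S N 0) x :
  I_point nN (T0_incl xi) (basis x) = T0_incl (I_T0 nN x xi).
Proof.
apply: weight_inj.
transitivity (weight (I_T0 nN x xi)); last by rewrite weight_T0_incl.
apply: (etrans (congr1 (push _) (weight_T0_incl xi))).
congr push; apply/funext => g.
by rewrite -[basis x]ract1 Defs.coord_basis mulg1.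
Qed.

(** This is where the recursion for [iota_n] comes from: [I (x) id] acts on the
    first two tensor factors only, so a point [xi (x) x] with [xi] in the image
    of [T n.+1] keeps its last letter. *)
Lemma I_tensor_tile n (t : T R S N n.+1) :
  exists t' : T R S N n, I_tensor nN (tile_incl t) = tile_incl t'.
Proof.
elim: n t => [|n IH]; elim/next_ind => xi x.
  exists (I_T0 nN x xi); rewrite (@tile_inclS 0 xi x).
  exact: etrans (I_tensor0 nN (T0_incl xi) (basis x)) (I_point_basis xi x).
have [t' e] := IH xi; exists (T_point t' x).
by rewrite (tile_inclS t' x) -e (@tile_inclS n.+1 xi x); exact: I_tensorS.
Qed.

End Tiles.

Theorem proposition6p5 (R : realType) (G : groupType) (S : selfSimilarGroup G)
    (N : set G)
    (Gfg : finitely_generated G)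
    (Scontracting : contracting S)
    (Srepl : self_replicating S)
    (nN : is_nucleus S N) :
  (* the rule defining kappa_(g,n) on K_(g,n) is single-valued *)
  (forall (n : nat) (g : G), N g -> g <> 1%g ->
     forall t : T R S N n, stage_K g t ->
       exists! t' : T R S N n, stage_kappa g t t') /\
  exists phi : forall n : nat, kappa_quotient N (T R S N n) -> J R S N n,
    (* J_n(G) is isomorphic to the quotient of T_n by the kappa_(g,n); for
       n = 0 the isomorphism is induced by the inclusion of T_0 in Gamma *)
    (forall n : nat, is_iso (@phi n)) /\
    (forall xi : T R S N 0,
       @phi 0 (to_kappa_quotient N xi) = to_J (T0_incl xi)) /\
    (* p_n is induced by (xi, x) |-> xi *)
    (forall (n : nat) (xi : T R S N n) (x : letter S),
       p_J (@phi n.+1 (to_kappa_quotient N (T_point xi x))) =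
       @phi n (to_kappa_quotient N xi)) /\
    (* iota_n is induced by a map T_(n+1) -> T_n, obtained recursively *)
    exists iota_T : forall n : nat, T R S N n.+1 -> T R S N n,
      (forall (xi : T R S N 0) (x : letter S),
         @iota_T 0 (T_point xi x) = I_T0 nN x xi) /\
      (forall (n : nat) (xi : T R S N n.+1) (x : letter S),
         @iota_T n.+1 (T_point xi x) = T_point (@iota_T n xi) x) /\
      (forall (n : nat) (xi : T R S N n.+1),
         iota_J nN (@phi n.+1 (to_kappa_quotient N xi)) =
         @phi n (to_kappa_quotient N (@iota_T n xi))).
Proof.
have dom n := tile_domain R nN n.
split=> [n g Ng _ t Kg|].
  have [t' kt'] := domain_kappa (dom n) Kg; exists t'; split=> // t'' kt''.
  apply: (domain_inj (dom n)).
  have e' := (domain_overlap (dom n) t t' g).2 (And3 Ng Kg kt').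
  have e'' := (domain_overlap (dom n) t t'' g).2 (And3 Ng Kg kt'').
  by rewrite -[LHS](rtransK _ g) -e' e'' rtransK.
pose phi n : kappa_quotient N (T R S N n) -> J R S N n :=
  domain_quotient (@tile_incl R G S N n).
have phiE n xi : phi n (to_kappa_quotient N xi) = to_J (tile_incl xi).
  exact: (domain_quotientE (dom n)).
exists phi; split=> [n|]; first exact: domain_quotient_iso.
split=> [xi|]; first exact: phiE.
split=> [n xi x|].
  by rewrite !phiE (tile_inclS nN xi x); exact: p_J_tens.
pose iota_T n t := sval (cid (@I_tensor_tile R G S N nN n t)).
have iota_TE n t : I_tensor nN (tile_incl t) = tile_incl (iota_T n t).
  by rewrite /iota_T; case: cid.
exists iota_T; split=> [xi x|].
  apply: (domain_inj (dom 0%N)); rewrite -iota_TE (tile_inclS nN xi x).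
  exact: etrans (I_tensor0 nN (T0_incl xi) (basis x)) (I_point_basis nN xi x).
split=> [n xi x|n xi].
  apply: (domain_inj (dom n.+1)); rewrite -iota_TE (tile_inclS nN xi x).
  rewrite (tile_inclS nN (iota_T n xi) x) -iota_TE; exact: I_tensorS.
rewrite !phiE -iota_TE /iota_J /to_J qliftE // => z _ [g ->].
by rewrite I_tensor_rtrans; apply/esym; exact: to_J_rtrans.
Qed.
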